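(* Let $X$ be a locally compact and locally connected Hausdorff topological space, and let $f: X^2\to X$ be a continuous binary operation on $X$. For $t\in X$ let $f_t:X\to X$ be the continuous map $f_t(x)=f(t,x)$. Then $f$ is invertible if and only if $f_t:X\to X$ is a homeomorphism for every $t\in X$.
   Context: A continuous binary operation on a topological space $X$ is a continuous map $f:X^2=X\times X\to X$. The composition of two continuous binary operations $f,\varphi$ is $(f\circ\varphi)(t,x)=f(t,\varphi(t,x))$, for $t,x\in X$. With this composition the set $C_2(X)$ of all continuous binary operations on $X$ is a monoid with identity element $e(t,x)=x$. A continuous binary operation $f\in C_2(X)$ is invertible if there exists $f^{-1}\in C_2(X)$ with $f\circ f^{-1}=f^{-1}\circ f=e$. *)

(* Defs.v *)
From mathcomp Require Import all_boot all_order all_algebra.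
From mathcomp Require Import all_classical topology.

Set Implicit Arguments.
Unset Strict Implicit.
Unset Printing Implicit Defensive.

Local Open Scope classical_set_scope.

Definition locally_connected (X : topologicalType) : Prop :=
  forall (x : X) (U : set X), nbhs x U ->
    exists V : set X, [/\ open_nbhs x V, connected V & V `<=` U].

Definition homeomorphism (X Y : topologicalType) (h : X -> Y) : Prop :=
  continuous h /\
  exists g : Y -> X, [/\ continuous g, cancel h g & cancel g h].

Definition C2 (X : topologicalType) : Type := continuousType (X * X)%type X.

Section BinaryOperations.
Context {X : topologicalType}.

Definition slice (f : C2 X) (t : X) : X -> X := fun x => f (t, x).

Lemma slice_continuous (f : C2 X) (t : X) : continuous (slice f t).
Proof.
move=> x; apply: (@continuous_comp _ _ _ (fun y : X => (t, y)) f).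
  by apply: cvg_pair => /=; [exact: cvg_cst | exact: cvg_id].
exact: cts_fun.
Qed.

Lemma C2_comp_continuous (f phi : C2 X) :
  continuous (fun p : X * X => f (p.1, phi p)).
Proof.
move=> p.
apply: (@continuous_comp _ _ _ (fun q : X * X => (q.1, phi q)) f).
  apply: cvg_pair => /=; first exact: cvg_fst.
  exact: cts_fun.
exact: cts_fun.
Qed.

Definition C2_comp (f phi : C2 X) : C2 X := mkcts (@C2_comp_continuous f phi).

Lemma C2_id_continuous : continuous (fun p : X * X => p.2).
Proof. by move=> p; exact: cvg_snd. Qed.

Definition C2_id : C2 X := mkcts C2_id_continuous.

Lemma C2_compE (f phi : C2 X) (t x : X) :
  C2_comp f phi (t, x) = f (t, phi (t, x)).
Proof. by []. Qed.

Lemma C2_idE (t x : X) : C2_id (t, x) = x.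
Proof. by []. Qed.

Lemma C2_compA : associative C2_comp.
Proof. by move=> f g h; apply/continuousEP => -[]. Qed.

Lemma C2_comp1f : left_id C2_id C2_comp.
Proof. by move=> f; apply/continuousEP => -[]. Qed.

Lemma C2_compf1 : right_id C2_id C2_comp.
Proof. by move=> f; apply/continuousEP => -[]. Qed.

Definition C2_invertible (f : C2 X) : Prop :=
  exists g : C2 X, C2_comp f g = C2_id /\ C2_comp g f = C2_id.

End BinaryOperations.

Arguments C2_id : clear implicits.

(* Main.v *)
(* Fix y0 = f(t0, x0) and an open neighbourhood O of x0 whose closure is
   compact.  The frontier B of O is compact and f(t0, -) misses y0 on B, so for
   (t, y) near (t0, y0) no point of B is sent to y by f(t, -).  Choosing a
   connected neighbourhood W of y0, the connected set f_t^-1(W) avoids B and,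
   for t near t0, contains x0; hence it lies inside O. *)
Require Import Defs.
From mathcomp Require Import all_boot all_order all_algebra.
From mathcomp Require Import all_classical topology.

Local Open Scope classical_set_scope.

(** Since [D] misses the frontier of [O], its traces on [O] and on [closure O] coincide. This trace
    is nonempty and clopen in [D], so connectedness makes it all of [D]. *)
Lemma connected_sub_open (X : topologicalType) (D O : set X) :
  connected D -> open O -> D `&` O !=set0 ->
  D `&` (closure O `\` O) = set0 -> D `<=` O.
Proof.
move=> Dconn Oop DO0 DB0.
have <- : D `&` O = D; last exact: subIsetr.
apply: Dconn => //; first by exists O.
exists (closure O); first exact: closed_closure.
apply/seteqP; split=> x [Dx Ox]; split=> //; first exact: subset_closure.
apply: contrapT => nOx.
by rewrite -[False]/((set0 : set X) x) -DB0.
Qed.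

Lemma hausdorff_near_neq (Y : topologicalType) (y z : Y) :
  hausdorff_space Y -> y <> z -> \forall p \near (y, z), p.1 <> p.2.
Proof.
rewrite open_hausdorff => hY /eqP /hY[[A B] /= [/set_mem Ay /set_mem Bz]].
move=> [Aop Bop /eqP AB0].
exists (A, B) => /=; first by split; apply: open_nbhs_nbhs.
move=> [a b] [/= Aa Bb] ab.
by rewrite -[False]/((set0 : set Y) a) -AB0; split; rewrite // ab.
Qed.

(** A tube lemma: each [x] in [B] has the inequality on a neighbourhood of [(x, (t0, y0))], and
    compactness in its near-covering form makes the neighbourhood of [(t0, y0)] uniform in [x]. *)
Lemma compact_near_avoid (T X Y : topologicalType) (f : T * X -> Y)
    (B : set X) (t0 : T) (y0 : Y) :
  hausdorff_space Y -> continuous f -> compact B ->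
  (forall x, B x -> f (t0, x) <> y0) ->
  \forall p \near (t0, y0), forall x, B x -> f (p.1, x) <> p.2.
Proof.
move=> hY fcts /compact_near_coveringP Bcpt fB.
apply: (Bcpt _ (nbhs (t0, y0)) (fun p x => f (p.1, x) <> p.2)) => x Bx.
have cts : (fun q : X * (T * Y) => (f (q.2.1, q.1), q.2.2)) @ (x, (t0, y0))
    --> (f (t0, x), y0).
  apply: cvg_pair => /=; last first.
    by apply: cvg_comp; [exact: cvg_snd | exact: cvg_snd].
  apply: (@cvg_comp _ _ _ (fun q : X * (T * Y) => (q.2.1, q.1)) f);
    last exact: fcts.
  apply: cvg_pair => /=; last exact: cvg_fst.
  by apply: cvg_comp; [exact: cvg_snd | exact: cvg_fst].
exact: (cts _ (hausdorff_near_neq _ _ _ hY (fB x Bx))).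
Qed.

Lemma inverse_slices_continuous (T X Y : topologicalType) (f : T * X -> Y)
    (g : T -> Y -> X) :
  locally_compact [set: X] -> locally_connected Y -> hausdorff_space Y ->
  continuous f -> (forall t, continuous (g t)) ->
  (forall t x, g t (f (t, x)) = x) -> (forall t y, f (t, g t y) = y) ->
  continuous (fun p : T * Y => g p.1 p.2).
Proof.
move=> lcX lcY hY fcts gcts fK gK [t0 y0] /= U; set x0 := g t0 y0 => Ux0.
have [K Kx0 [Kcpt Kcl]] : exists2 K, nbhs x0 K & compact K /\ closed K.
  by have [K] := lcX x0 I; rewrite withinET; exists K.
(* [U] makes landing in [O] sufficient; the closed compact [K] contains [closure O], which makes the
   frontier compact. *)
pose O := interior (U `&` K).
have Oop : open O by exact: open_interior.
have Ox0 : O x0 by apply: filterI.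
have OU : O `<=` U by move=> x /interior_subset[].
have Bcpt : compact (closure O `\` O).
  apply: (subclosed_compact _ Kcpt).
    by apply: closedI; [exact: closed_closure | exact: open_closedC].
  move=> x [+ _]; rewrite [K](closure_id K).1//.
  by apply: closureS => z /interior_subset[].
(* By injectivity of [f (t0, -)], only [x0] is sent to [y0], and [x0] lies in [O]. *)
have Bavoid x : (closure O `\` O) x -> f (t0, x) <> y0.
  by move=> [_ nOx] fx; apply: nOx; rewrite -(fK t0 x) fx.
have [[A V] /= [At0 Vy0] AV] :=
  compact_near_avoid _ _ _ f _ _ _ hY fcts Bcpt Bavoid.
have [W [[Wop Wy0] Wconn WV]] := lcY y0 V Vy0.
have Nt0 : \forall t \near t0, W (f (t, x0)).
  have cts : (fun t => f (t, x0)) @ t0 --> y0.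
    rewrite -(gK t0 y0).
    apply: (@cvg_comp _ _ _ (fun t => (t, x0)) f); last exact: fcts.
    by apply: cvg_pair => /=; [exact: cvg_id | exact: cvg_cst].
  by apply: cts; exact: open_nbhs_nbhs.
exists (A `&` [set t | W (f (t, x0))], W) => /=.
  by split; [exact: filterI | exact: open_nbhs_nbhs].
move=> [t y] [/= [At Wt] Wy]; apply: OU.
suff : g t @` W `<=` O by apply; exists y.
apply: connected_sub_open => //.
(* Only continuity of the single map [g t] enters here, nothing about how it varies with [t]. *)
- apply: connected_continuous_connected => //.
  exact: continuous_subspaceT.
- by exists x0; split => //; exists (f (t, x0)).
- rewrite -subset0 => _ [[w Ww <-] Bw].
  (* A frontier point [g t w] would be sent by [f (t, -)] to [w], which lies in [V]. *)
  by apply: (AV (t, w) _ _ Bw); [split; [|exact: WV] | rewrite /= gK].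
Qed.

Theorem theorem5 (X : topologicalType)
    (X_locally_compact : locally_compact [set: X])
    (X_locally_connected : locally_connected X)
    (X_hausdorff : hausdorff_space X)
    (f : C2 X) :
  C2_invertible f <-> forall t : X, homeomorphism (slice f t).
Proof.
split=> [[g [fg gf]] t|fhomeo].
  split; first exact: slice_continuous.
  exists (slice g t); split; first exact: slice_continuous.
  - by move=> x; rewrite /slice -C2_compE gf.
  - by move=> x; rewrite /slice -C2_compE fg.
(* The inverses are chosen independently for each [t]; their joint continuity has to be proved. *)
have /choice[g gP] := fun t => (fhomeo t).2.
have gcts : continuous (fun p : X * X => g p.1 p.2).
  apply: (inverse_slices_continuous _ _ _ f g) => //.
  - exact: cts_fun.
  - by move=> t; have [] := gP t.
  - by move=> t x; have [_ fK _] := gP t; exact: fK.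
  - by move=> t y; have [_ _ gK] := gP t; exact: gK.
exists (mkcts gcts); split; apply/continuousEP => -[t x].
- by have [_ _ gK] := gP t; exact: gK.
- by have [_ fK _] := gP t; exact: fK.
Qed.
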